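(* For every $\varepsilon>0$ there exist $\delta>0$ and $N$ such that for every $n\geq N$ the following holds. If $A=(a_{ij})$ is a nonnegative real $n\times n$ matrix with maximum entry $\alpha>2\varepsilon$ and $\mathcal{E}(A)\geq\alpha(1/2-\delta)n^{3/2}$, then: (i) $a_{ij}>(1-\varepsilon)\alpha$ for at least $(1/2-\varepsilon)n^2$ entries $a_{ij}$ of $A$; (ii) $a_{ij}<\varepsilon\alpha$ for at least $(1/2-\varepsilon)n^2$ entries $a_{ij}$ of $A$; (iii) $|\sigma_1(A)-\alpha n/2|<\varepsilon\alpha n$; (iv) $\sigma_2(A)<\varepsilon\alpha n$; (v) $|\sigma_i(A)-\alpha n^{1/2}/2|<\varepsilon\alpha n^{1/2}$ for all integers $i$ with $\varepsilon n\leq i\leq(1-\varepsilon)n$.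
   Context: For a complex $m\times n$ matrix $A$, its singular values $\sigma_1(A)\geq\sigma_2(A)\geq\cdots$ are the square roots of the eigenvalues of $AA^{\ast}$ (where $A^{\ast}$ is the Hermitian adjoint), and the energy of $A$ is $\mathcal{E}(A)=\sigma_1(A)+\sigma_2(A)+\cdots$. *)

(* Defs.v *)
From HB Require Import structures.
From mathcomp Require Export all_boot all_order all_algebra.
From mathcomp Require Export complex.
From mathcomp Require Export reals exp.

Set Implicit Arguments.
Unset Strict Implicit.
Unset Printing Implicit Defensive.

Import Order.TTheory GRing.Theory Num.Theory.
Local Open Scope ring_scope.
Local Open Scope sesquilinear_scope.

(* The eigenvalues of a complex square matrix, repeated according to their
   algebraic multiplicity, in an unspecified order. *)
Definition eigenvalues (R : rcfType) (n : nat) (M : 'M[R[i]]_n) : seq R[i] :=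
  sval (closed_field_poly_normal (char_poly M)).

(* The eigenvalues of A A^* are nonnegative reals, so taking the real part only
   changes their type from R[i] to R. *)
Definition singular_values (R : rcfType) (m n : nat) (A : 'M[R[i]]_(m, n)) :
    seq R :=
  sort >=%R [seq Num.sqrt (complex.Re z) | z <- eigenvalues (A *m A ^t*)].

(* Numbered from 1: [sigma A 1] is the largest singular value. The index 0 is
   meaningless, and indices larger than m give 0. *)
Definition sigma (R : rcfType) (m n : nat) (A : 'M[R[i]]_(m, n)) (k : nat) : R :=
  (singular_values A)`_k.-1.

Definition energy (R : rcfType) (m n : nat) (A : 'M[R[i]]_(m, n)) : R :=
  \sum_(1 <= k < m.+1) sigma A k.

Definition complexmx (R : rcfType) (m n : nat) (A : 'M[R]_(m, n)) :
    'M[R[i]]_(m, n) :=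
  map_mx (real_complex R) A.

Definition nonneg_mx (R : rcfType) (m n : nat) (A : 'M[R]_(m, n)) : Prop :=
  forall i j, 0 <= A i j.

Definition is_max_entry (R : rcfType) (m n : nat) (A : 'M[R]_(m, n)) (a : R) :
    Prop :=
  (exists i j, A i j = a) /\ (forall i j, A i j <= a).

Definition count_entries (R : rcfType) (m n : nat) (P : pred R)
    (A : 'M[R]_(m, n)) : nat :=
  #|[pred p : 'I_m * 'I_n | P (A p.1 p.2)]|.

(* Main.v *)
Require Import Defs.
From mathcomp Require Import all_boot all_order all_algebra complex reals exp.
From mathcomp Require Import spectral ring lra.

(* Write S and Q for the sums of the entries of A and of their squares, L for
   alpha * n, and s_k for the singular values. Then Q = sum_k s_k ^ 2 and
   Q <= alpha * S <= L * s_1. Since s_1 + s_2 <= 2 * L is negligible against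
   n ^ (3/2), Cauchy-Schwarz on the remaining singular values gives
   (1/2 - d) ^ 2 * L ^ 2 <= Q - s_1 ^ 2 - s_2 ^ 2 for a small d, that is
     s_2 ^ 2 + (s_1 - L / 2) ^ 2 + (L * s_1 - Q) <= d * L ^ 2.
   So s_2 is small and s_1 is close to L / 2. Moreover alpha * S - Q, the sum of
   all a * (alpha - a), is small, so almost all entries are close to 0 or alpha,
   and S is close to L * n / 2. Expanding the square, the sum over k >= 3 of
   (s_k - alpha * sqrt n / 2) ^ 2 is at most d * L ^ 2, and monotonicity turns
   this mean bound into a pointwise one away from both ends. *)

Set Implicit Arguments.
Unset Strict Implicit.
Unset Printing Implicit Defensive.

Import Order.TTheory GRing.Theory Num.Theory.
Local Open Scope ring_scope.
Local Open Scope sesquilinear_scope.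

(** * Similar matrices and adjoints *)

Lemma char_poly_conj (F : comUnitRingType) (n : nat) (P D : 'M[F]_n) :
  P \in unitmx -> char_poly (invmx P *m D *m P) = char_poly D.
Proof.
move=> Pu; rewrite /char_poly.
have -> : char_poly_mx (invmx P *m D *m P) =
    map_mx polyC (invmx P) *m char_poly_mx D *m map_mx polyC P.
  rewrite /char_poly_mx mulmxBr mulmxBl !map_mxM; congr (_ - _).
  by rewrite -scalemx1 -scalemxAr -scalemxAl mulmx1 -map_mxM mulVmx // map_mx1.
by rewrite !det_mulmx mulrAC -det_mulmx -map_mxM mulVmx // map_mx1 det1 mul1r.
Qed.

Section Adjoint.
Variable C : numClosedFieldType.

Lemma adjmxM (m n p : nat) (A : 'M[C]_(m, n)) (B : 'M[C]_(n, p)) :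
  (A *m B) ^t* = B ^t* *m A ^t*.
Proof. by rewrite trmx_mul map_mxM. Qed.

Lemma adjmxK (m n : nat) (A : 'M[C]_(m, n)) : (A ^t*) ^t* = A.
Proof. by apply/matrixP=> i j; rewrite !mxE conjCK. Qed.

Lemma gram_diag (m n : nat) (A : 'M[C]_(m, n)) i :
  (A *m A ^t*) i i = \sum_j `|A i j| ^+ 2.
Proof. by rewrite mxE; apply: eq_bigr => j _; rewrite !mxE normCK. Qed.

End Adjoint.

(** * Singular values through the spectral theorem *)

Section SingularValues.
Variable R : rcfType.

(** [A *m A ^t*] is Hermitian, so the spectral theorem applies. Its diagonal factor is the Gram
    matrix of [P *m A], whose diagonal entries are sums of squared moduli. *)
Lemma gram_spectral (m n : nat) (A : 'M[R[i]]_(m, n)) :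
  exists (P : 'M[R[i]]_m) (d : 'I_m -> R),
    [/\ P \is unitarymx, forall i, 0 <= d i &
        A *m A ^t* = P ^t* *m diag_mx (\row_i (d i)%:C%C) *m P].
Proof.
set M := A *m A ^t*.
have Mherm : M ^t* = M by rewrite adjmxM adjmxK.
have /orthomx_spectralP : M \is normalmx by apply/normalmxP; rewrite Mherm.
move: (spectral_unitarymx M); set P := spectralmx M; set sp := spectral_diag M.
move=> Pu; rewrite invmx_unitary // => ME.
have dE : diag_mx sp = (P *m A) *m (P *m A) ^t*.
  rewrite adjmxM !mulmxA -(mulmxA P) -/M {1}ME !mulmxA (unitarymxP Pu) mul1mx.
  by rewrite mulmxtVK.
have sp_ge0 i : 0 <= sp 0 i.
  have := gram_diag (P *m A) i; rewrite -dE mxE eqxx mulr1n => ->.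
  by apply: sumr_ge0 => j _; rewrite exprn_ge0.
exists P, (fun i => complex.Re (sp 0 i)); split=> // [i|].
  by have := sp_ge0 i; rewrite lecE => /andP[].
rewrite {1}ME; congr (_ *m diag_mx _ *m _); apply/rowP => i; rewrite mxE.
by have := sp_ge0 i; rewrite lecE; case: (sp 0 i) => a b /= /andP[/eqP -> _].
Qed.

(** Links the roots of the characteristic polynomial to spectral data: two factorisations into monic
    linear factors agree up to order. *)
Lemma perm_singular_values (m n : nat) (A : 'M[R[i]]_(m, n)) (P : 'M[R[i]]_m)
    (d : 'I_m -> R) :
  P \is unitarymx -> A *m A ^t* = P ^t* *m diag_mx (\row_i (d i)%:C%C) *m P ->
  perm_eq (singular_values A) [seq Num.sqrt (d i) | i <- enum 'I_m].
Proof.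
move=> Pu AE; rewrite /singular_values perm_sort.
have -> : [seq Num.sqrt (d i) | i <- enum 'I_m] =
    [seq Num.sqrt (complex.Re z) | z <- [seq (d i)%:C%C | i <- enum 'I_m]].
  by rewrite -[RHS]map_comp.
apply: perm_map; apply: prod_XsubC_eq.
rewrite /eigenvalues; case: closed_field_poly_normal => r /= rE.
move: rE; rewrite (monicP (char_poly_monic _)) scale1r => <-.
rewrite AE -invmx_unitary // char_poly_conj ?unitarymx_unit //.
rewrite char_poly_trig ?diag_mx_is_trig // big_map big_enum /=.
by apply: eq_bigr => i _; rewrite !mxE eqxx mulr1n.
Qed.

Lemma size_singular_values (m n : nat) (A : 'M[R[i]]_(m, n)) :
  size (singular_values A) = m.
Proof.
have [P [d [Pu d0 AE]]] := gram_spectral A.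
by rewrite (perm_size (perm_singular_values Pu AE)) size_map size_enum_ord.
Qed.

Lemma singular_values_ge0 (m n : nat) (A : 'M[R[i]]_(m, n)) s :
  s \in singular_values A -> 0 <= s.
Proof. by rewrite mem_sort => /mapP[z _ ->]; rewrite sqrtr_ge0. Qed.

Lemma sigma_ge0 (m n : nat) (A : 'M[R[i]]_(m, n)) k : 0 <= sigma A k.
Proof.
rewrite /sigma; have [lt|ge] := ltnP k.-1 (size (singular_values A)).
  by apply/singular_values_ge0/mem_nth.
by rewrite nth_default.
Qed.

(** No range condition is needed: index 0 reads the same value as index 1, and past the end the
    default 0 lies below every singular value. *)
Lemma sigma_le (m n : nat) (A : 'M[R[i]]_(m, n)) j k :
  (j <= k)%N -> sigma A k <= sigma A j.
Proof.
move=> jk; rewrite /sigma.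
have srt : sorted >=%R (singular_values A).
  by apply: (@sort_sorted _ >=%R) => x y; exact: le_total.
have [lt|ge] := ltnP k.-1 (size (singular_values A)); last first.
  by rewrite (nth_default _ ge) (sigma_ge0 A j).
have jk' : (j.-1 <= k.-1)%N by rewrite -!subn1 leq_sub2r.
apply: (sorted_leq_nth (leT := >=%R)) => //.
- by move=> x y z /= yx xz; exact: le_trans xz yx.
- by move=> x /=; exact: lexx.
- by rewrite inE (leq_ltn_trans jk').
Qed.

(** Both sides are the trace of [A *m A ^t*]. *)
Lemma sum_sigma_sqr (m n : nat) (A : 'M[R[i]]_(m, n)) :
  ((\sum_(1 <= k < m.+1) sigma A k ^+ 2)%:C)%C
  = \sum_i \sum_j `|A i j| ^+ 2.
Proof.
have [P [d [Pu d0 AE]]] := gram_spectral A.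
have -> : \sum_(1 <= k < m.+1) sigma A k ^+ 2
    = \sum_(s <- singular_values A) s ^+ 2.
  by rewrite big_add1 [RHS](big_nth 0) size_singular_values.
rewrite (perm_big _ (perm_singular_values Pu AE)) big_map big_enum /=.
rewrite (eq_bigr d) => [|i _]; last by rewrite sqr_sqrtr.
transitivity (\tr (A *m A ^t*)).
  rewrite AE mxtrace_mulC mulmxA (unitarymxP Pu) mul1mx mxtrace_diag.
  by rewrite rmorph_sum; apply: eq_bigr => i _; rewrite mxE.
by apply: eq_bigr => i _; rewrite gram_diag.
Qed.

(** In the coordinates [w = v *m P ^t*], which have the same norm as [v], the left side is the sum
    of [d i * |w i| ^ 2], and each [d i] is the square of a singular value. *)
Lemma mulmx_norm_le_sigma1 (m n : nat) (A : 'M[R[i]]_(m, n)) (v : 'rV[R[i]]_m) :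
  \sum_j `|(v *m A) 0 j| ^+ 2 <= ((sigma A 1) ^+ 2)%:C%C * \sum_i `|v 0 i| ^+ 2.
Proof.
have [P [d [Pu d0 AE]]] := gram_spectral A.
have dle i : d i <= sigma A 1 ^+ 2.
  have : Num.sqrt (d i) \in singular_values A.
    rewrite (perm_mem (perm_singular_values Pu AE)); apply/mapP.
    by exists i; rewrite ?mem_enum.
  move=> /(nthP 0)[k ks kE].
  rewrite -[d i]sqr_sqrtr // -kE lerXn2r ?nnegrE ?sigma_ge0 //.
    by rewrite (sigma_ge0 A k.+1).
  by apply: (sigma_le A (j := 1) (k := k.+1)).
rewrite -!gram_diag adjmxM !mulmxA -(mulmxA v) AE.
have -> : v *m v ^t* = (v *m P ^t*) *m (v *m P ^t*) ^t*.
  by rewrite adjmxM adjmxK mulmxA mulmxKtV.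
rewrite gram_diag.
have -> : v *m (P ^t* *m diag_mx (\row_i (d i)%:C%C) *m P) *m v ^t* =
  (v *m P ^t*) *m diag_mx (\row_i (d i)%:C%C) *m (v *m P ^t*) ^t*.
  by rewrite adjmxM adjmxK !mulmxA.
set w := v *m P ^t*; rewrite mul_mx_diag mxE mulr_sumr ler_sum // => i _.
by rewrite !mxE mulrAC -normCK mulrC ler_wpM2r ?exprn_ge0 // lecR.
Qed.

End SingularValues.

(** * Real matrices: Cauchy-Schwarz, entry counts, monotone sequences *)

Section RealMatrices.
Variable R : rcfType.

Lemma normc_real_sqr (x : R) : `|x%:C%C| ^+ 2 = (x ^+ 2)%:C%C.
Proof. by rewrite normCK [_^*](conjc_real x) -rmorphM. Qed.

Lemma sum_sigma_sqr_real (m n : nat) (A : 'M[R]_(m, n)) :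
  \sum_(1 <= k < m.+1) sigma (complexmx A) k ^+ 2 = \sum_i \sum_j A i j ^+ 2.
Proof.
apply: (@complexI R); rewrite [LHS]sum_sigma_sqr rmorph_sum.
apply: eq_bigr => i _; rewrite rmorph_sum.
by apply: eq_bigr => j _; rewrite mxE normc_real_sqr.
Qed.

Lemma sum_sqr_sub (I : Type) (r : seq I) (F : I -> R) (t : R) :
  \sum_(i <- r) (F i - t) ^+ 2
  = \sum_(i <- r) F i ^+ 2 - 2 * t * \sum_(i <- r) F i + (size r)%:R * t ^+ 2.
Proof.
elim: r => [|a r IH]; first by rewrite !big_nil /=; ring.
by rewrite !big_cons IH /= -natr1; ring.
Qed.

(** Cauchy-Schwarz, from the nonnegativity of the sum of squared deviations from the mean. *)
Lemma sqr_sum_le (I : Type) (r : seq I) (F : I -> R) :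
  (\sum_(i <- r) F i) ^+ 2 <= (size r)%:R * \sum_(i <- r) F i ^+ 2.
Proof.
case: r => [|a r]; first by rewrite !big_nil /=; lra.
set s := a :: r; set S := \sum_(i <- s) F i; set Q := \sum_(i <- s) _.
have k0 : 0 < (size s)%:R :> R by rewrite ltr0n.
have : 0 <= \sum_(i <- s) (F i - S / (size s)%:R) ^+ 2.
  by apply: sumr_ge0 => i _; exact: sqr_ge0.
rewrite sum_sqr_sub -/S -/Q.
have -> : Q - 2 * (S / (size s)%:R) * S + (size s)%:R * (S / (size s)%:R) ^+ 2
  = Q - S ^+ 2 / (size s)%:R by field; rewrite gt_eqF.
by rewrite subr_ge0 ler_pdivrMr // mulrC.
Qed.

(** The all-ones vector turns the norm bound into one on the squared column sums; Cauchy-Schwarz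
    over the [n] columns finishes. *)
Lemma sum_entries_le (m n : nat) (A : 'M[R]_(m, n)) :
  (\sum_i \sum_j A i j) ^+ 2 <= n%:R * m%:R * sigma (complexmx A) 1 ^+ 2.
Proof.
have := mulmx_norm_le_sigma1 (complexmx A) (const_mx 1).
have -> : \sum_i `|(const_mx 1 : 'rV[R[i]]_m) 0 i| ^+ 2 = (m%:R)%:C%C.
  rewrite (eq_bigr (fun=> 1)) => [|i _]; last by rewrite mxE normr1 expr1n.
  by rewrite sumr_const card_ord rmorph_nat.
have colE j : (const_mx 1 *m complexmx A) 0 j = (\sum_i A i j)%:C%C.
  by rewrite mxE rmorph_sum; apply: eq_bigr => i _; rewrite !mxE mul1r.
under eq_bigr => j _ do rewrite colE normc_real_sqr.
rewrite -rmorph_sum -rmorphM lecR => le.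
rewrite exchange_big /=; apply: le_trans (sqr_sum_le _ _) _.
rewrite -[index_enum _]enumT size_enum_ord -mulrA ler_wpM2l ?ler0n //.
by rewrite mulrC enumT.
Qed.

Lemma count_entriesE (m n : nat) (P : pred R) (A : 'M[R]_(m, n)) :
  (count_entries P A)%:R = \sum_i \sum_j (P (A i j))%:R :> R.
Proof.
rewrite /count_entries -sum1_card natr_sum pair_big /= big_mkcond /=.
by apply: eq_bigr => p _; rewrite inE; case: (P _).
Qed.

(* Pointwise, [a ^ 2] is at most [alpha ^ 2] if [a > (1 - eps) * alpha], and at
   most [a * (alpha - a) / eps] otherwise. *)
Lemma count_large_entries (m n : nat) (A : 'M[R]_(m, n)) (alpha eps : R) :
  0 < eps -> (forall i j, 0 <= A i j <= alpha) ->
  \sum_i \sum_j A i j ^+ 2 <=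
  alpha ^+ 2 * (count_entries (fun x : R => (1 - eps) * alpha < x) A)%:R
  + eps^-1 * (alpha * \sum_i \sum_j A i j - \sum_i \sum_j A i j ^+ 2).
Proof.
move=> e0 Aa; rewrite count_entriesE !mulr_sumr -sumrB mulr_sumr -big_split /=.
apply: ler_sum => i _.
rewrite !mulr_sumr -sumrB mulr_sumr -big_split /=; apply: ler_sum => j _.
have /andP[a0 aa] := Aa i j; move: (A i j) a0 aa => a a0 aa.
have q0 : 0 <= eps^-1 * (alpha * a - a ^+ 2).
  by rewrite mulr_ge0 ?invr_ge0 ?(ltW e0) //; nra.
case: ltP => [_|le] /=; first by nra.
have le2 : a * eps <= alpha - a by nra.
by rewrite mulr0 add0r [leRHS]mulrC ler_pdivlMr //; nra.
Qed.

(** Mirror image of the previous count: replacing [a] by [alpha - a] preserves [a * (alpha - a)] and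
    exchanges the two conditions. *)
Lemma count_small_entries (m n : nat) (A : 'M[R]_(m, n)) (alpha eps : R) :
  0 < eps -> (forall i j, 0 <= A i j <= alpha) ->
  \sum_i \sum_j (alpha - A i j) ^+ 2 <=
  alpha ^+ 2 * (count_entries (fun x : R => x < eps * alpha) A)%:R
  + eps^-1 * (alpha * \sum_i \sum_j A i j - \sum_i \sum_j A i j ^+ 2).
Proof.
move=> e0 Aa; rewrite count_entriesE !mulr_sumr -sumrB mulr_sumr -big_split /=.
apply: ler_sum => i _.
rewrite !mulr_sumr -sumrB mulr_sumr -big_split /=; apply: ler_sum => j _.
have /andP[a0 aa] := Aa i j; move: (A i j) a0 aa => a a0 aa.
have q0 : 0 <= eps^-1 * (alpha * a - a ^+ 2).
  by rewrite mulr_ge0 ?invr_ge0 ?(ltW e0) //; nra.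
case: ltP => [_|le] /=; first by nra.
have le2 : (alpha - a) * eps <= a by nra.
by rewrite mulr0 add0r [leRHS]mulrC ler_pdivlMr //; nra.
Qed.

Lemma sum_complement_sqr (n : nat) (A : 'M[R]_n) (alpha : R) :
  \sum_i \sum_j (alpha - A i j) ^+ 2 =
  n%:R ^+ 2 * alpha ^+ 2 - 2 * alpha * \sum_i \sum_j A i j
  + \sum_i \sum_j A i j ^+ 2.
Proof.
rewrite mulr_sumr.
have -> : n%:R ^+ 2 * alpha ^+ 2 = \sum_(i < n) n%:R * alpha ^+ 2.
  by rewrite sumr_const card_ord -[RHS]mulr_natl mulrA expr2.
rewrite -sumrB -big_split /=; apply: eq_bigr => i _; rewrite mulr_sumr.
have -> : n%:R * alpha ^+ 2 = \sum_(j < n) alpha ^+ 2.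
  by rewrite sumr_const card_ord mulr_natl.
by rewrite -sumrB -big_split /=; apply: eq_bigr => j _; ring.
Qed.

Lemma sum_nat_ge (F : nat -> R) (c : R) (a a' b' b : nat) :
  (a <= a')%N -> (a' <= b')%N -> (b' <= b)%N -> (forall k, 0 <= F k) ->
  (forall k, (a' <= k < b')%N -> c <= F k) ->
  (b' - a')%:R * c <= \sum_(a <= k < b) F k.
Proof.
move=> aa ab bb F0 Fc.
rewrite (@big_cat_nat _ _ _ a') ?(leq_trans ab) //=.
rewrite (@big_cat_nat _ _ _ b' a') //=.
have le : (b' - a')%:R * c <= \sum_(a' <= k < b') F k.
  by rewrite mulr_natl -sumr_const_nat !big_nat; apply: ler_sum => k /Fc.
have F_ge0 u v : 0 <= \sum_(u <= k < v) F k by apply: sumr_ge0.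
by apply: (le_trans le); rewrite addrCA lerDl addr_ge0.
Qed.

(* If a nonincreasing sequence is far from [t] at [i], then it is at least as
   far from [t] at all smaller indices, or at all larger ones. *)
Lemma nonincreasing_near (s : nat -> R) (n i : nat) (t h D : R) :
  (forall j k, (j <= k)%N -> s k <= s j) -> 0 <= h -> (3 <= i <= n)%N ->
  \sum_(3 <= k < n.+1) (s k - t) ^+ 2 <= D ->
  D < (i - 2)%:R * h ^+ 2 -> D < (n.+1 - i)%:R * h ^+ 2 ->
  `|s i - t| < h.
Proof.
move=> sle h0 /andP[i3 iln] sD D1 D2; rewrite ltr_norml.
apply/andP; split; rewrite ltNge; apply/negP => far.
- move: D2; apply/negP; rewrite -leNgt; apply: le_trans sD.
  apply: sum_nat_ge => //; first by rewrite leqW.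
  + by move=> k; exact: sqr_ge0.
  + by move=> k /andP[/sle le _]; nra.
- move: D1; apply/negP; rewrite -leNgt; apply: le_trans sD.
  have -> : (i - 2 = i.+1 - 3)%N by [].
  apply: sum_nat_ge => //.
  + by rewrite leqW.
  + by move=> k; exact: sqr_ge0.
  + by move=> k /andP[_]; rewrite ltnS => /sle le; nra.
Qed.

End RealMatrices.

(** * Consequences of a large energy *)

Section LargeEnergy.
Variables (R : rcfType) (n : nat) (A : 'M[R]_n) (alpha : R).
Hypotheses (n_ge2 : (2 <= n)%N) (alpha_gt0 : 0 < alpha).
Hypothesis A_bounds : forall i j, 0 <= A i j <= alpha.

Let s k := sigma (complexmx A) k.
Let S := \sum_i \sum_j A i j.
Let Q := \sum_i \sum_j A i j ^+ 2.
Let T3 := \sum_(3 <= k < n.+1) s k.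
Let Q3 := \sum_(3 <= k < n.+1) s k ^+ 2.

Lemma sum_sqr_entries_le : Q <= alpha * S.
Proof.
rewrite mulr_sumr; apply: ler_sum => i _; rewrite mulr_sumr.
by apply: ler_sum => j _; have /andP[? ?] := A_bounds i j; nra.
Qed.

Lemma sum_entries_le_sigma1 : S <= n%:R * s 1.
Proof.
have S0 : 0 <= S.
  apply: sumr_ge0 => i _; apply: sumr_ge0 => j _.
  by have /andP[] := A_bounds i j.
rewrite -(@ler_pXn2r _ 2) ?nnegrE ?mulr_ge0 ?ler0n ?sigma_ge0 //.
by rewrite exprMn [n%:R ^+ 2]expr2; exact: sum_entries_le.
Qed.

Lemma sum_sqr_sigma_split : Q = s 1 ^+ 2 + s 2 ^+ 2 + Q3.
Proof.
by rewrite /Q -sum_sigma_sqr_real big_ltn ?(leqW n_ge2) // big_ltn // addrA.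
Qed.

Lemma energy_split : energy (complexmx A) = s 1 + s 2 + T3.
Proof. by rewrite /energy big_ltn ?(leqW n_ge2) // big_ltn // addrA. Qed.

Lemma tail_sqr_ge0 : 0 <= Q3.
Proof. by apply: sumr_ge0 => k _; exact: sqr_ge0. Qed.

Lemma sum_sqr_entries_le_sqr : Q <= (alpha * n%:R) ^+ 2.
Proof.
have -> : (alpha * n%:R) ^+ 2 = \sum_(i < n) \sum_(j < n) alpha ^+ 2.
  by rewrite !sumr_const card_ord -mulrnA -[RHS]mulr_natl natrM; ring.
apply: ler_sum => i _; apply: ler_sum => j _.
by have /andP[? ?] := A_bounds i j; rewrite lerXn2r ?nnegrE ?(ltW alpha_gt0).
Qed.

(** Crude bounds, which suffice to discard the first two terms of the energy: their sum is only of
    order [n]. *)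
Lemma sigma1_sigma2_le : s 1 <= alpha * n%:R /\ s 2 <= alpha * n%:R.
Proof.
have L0 : 0 <= alpha * n%:R by rewrite mulr_ge0 ?ler0n ?(ltW alpha_gt0).
have := sum_sqr_entries_le_sqr; have := tail_sqr_ge0.
have := sqr_ge0 (s 1); have := sqr_ge0 (s 2); rewrite sum_sqr_sigma_split.
move=> ? ? ? ?; split; rewrite -(@ler_pXn2r _ 2) ?nnegrE ?sigma_ge0 //; lra.
Qed.

Variable d : R.
Hypothesis d_le : d <= 1 / 2.
Hypothesis T3_ge : alpha * (1 / 2 - d) * (n%:R * Num.sqrt n%:R) <= T3.

Let size_tail : (size (index_iota 3 n.+1))%:R <= n%:R :> R.
Proof. by rewrite size_iota ler_nat subSS leq_subr. Qed.

Let n_gt0 : 0 < n%:R :> R.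
Proof. by rewrite ltr0n (leq_trans _ n_ge2). Qed.

Let sqr_sqrtn : Num.sqrt n%:R ^+ 2 = n%:R :> R.
Proof. by rewrite sqr_sqrtr ?ler0n. Qed.

Lemma tail_sqr_ge : (1 / 2 - d) ^+ 2 * (alpha * n%:R) ^+ 2 <= Q3.
Proof.
rewrite -(ler_pM2l n_gt0).
have -> : n%:R * ((1 / 2 - d) ^+ 2 * (alpha * n%:R) ^+ 2)
    = (alpha * (1 / 2 - d) * (n%:R * Num.sqrt n%:R)) ^+ 2.
  by rewrite !exprMn sqr_sqrtn; ring.
apply: (@le_trans _ _ (T3 ^+ 2)).
  have L0 : 0 <= alpha * (1 / 2 - d) * (n%:R * Num.sqrt n%:R).
    by rewrite !mulr_ge0 ?sqrtr_ge0 ?ler0n ?(ltW alpha_gt0) // subr_ge0.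
  by rewrite lerXn2r ?nnegrE // (le_trans L0).
apply: (le_trans (sqr_sum_le _ _)).
by rewrite ler_wpM2r // tail_sqr_ge0.
Qed.

(* All three summands are nonnegative, hence each of them is small. *)
Lemma energy_defect :
  s 2 ^+ 2 + (s 1 - alpha * n%:R / 2) ^+ 2 + (alpha * n%:R * s 1 - Q)
  <= d * (alpha * n%:R) ^+ 2.
Proof.
(* With [L = alpha * n], the terms linear in [s 1] cancel and the left side equals [L ^ 2 / 4 - Q3],
   which is at most [(d - d ^ 2) * L ^ 2]. *)
have := tail_sqr_ge; have := sum_sqr_sigma_split.
have := mulr_ge0 (sqr_ge0 d) (sqr_ge0 (alpha * n%:R)).
by move: (alpha * n%:R) => L ? ? ?; lra.
Qed.

Lemma tail_spread :
  \sum_(3 <= k < n.+1) (s k - alpha * Num.sqrt n%:R / 2) ^+ 2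
  <= d * (alpha * n%:R) ^+ 2.
Proof.
(* With [L = alpha * n], the expansion has three terms: [Q3 <= L * s 1 - s 1 ^ 2 <= L ^ 2 / 4], a
   cross term of at most [- (1 / 2 - d) * L ^ 2], and a constant term of at most [L ^ 2 / 4]. *)
rewrite sum_sqr_sub -/T3 -/Q3.
have r0 : 0 <= Num.sqrt n%:R :> R := sqrtr_ge0 _.
have hT := ler_wpM2l (mulr_ge0 (ltW alpha_gt0) r0) T3_ge.
have sz : (size (index_iota 3 n.+1))%:R * (alpha * Num.sqrt n%:R / 2) ^+ 2
    <= (alpha * n%:R) ^+ 2 / 4.
  apply: (le_trans (ler_wpM2r (sqr_ge0 _) size_tail)).
  by rewrite !exprMn sqr_sqrtn; lra.
have hQ := sum_sqr_sigma_split; have hS := sum_entries_le_sigma1.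
have hA := sum_sqr_entries_le; have hs := sqr_ge0 (s 2).
have hS' := ler_wpM2l (ltW alpha_gt0) hS.
have hx := sqr_ge0 (s 1 - alpha * n%:R / 2).
have TE : alpha * Num.sqrt n%:R * (alpha * (1 / 2 - d) * (n%:R * Num.sqrt n%:R))
    = (1 / 2 - d) * (alpha * n%:R) ^+ 2.
  transitivity ((1 / 2 - d) * alpha ^+ 2 * n%:R * Num.sqrt n%:R ^+ 2).
    by ring.
  by rewrite sqr_sqrtn; ring.
rewrite TE in hT; lra.
Qed.

End LargeEnergy.

Theorem theorem2 (R : realType) (eps : R) (heps : 0 < eps) :
  exists (delta : R) (N : nat), 0 < delta /\
  forall n : nat, (N <= n)%N ->
  forall (A : 'M[R]_n) (alpha : R),
    nonneg_mx A ->
    is_max_entry A alpha ->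
    2 * eps < alpha ->
    alpha * (1 / 2 - delta) * (n%:R `^ (3 / 2)) <= energy (complexmx A) ->
    [/\ (1 / 2 - eps) * n%:R ^+ 2
          <= (count_entries (fun x : R => (1 - eps) * alpha < x) A)%:R,
        (1 / 2 - eps) * n%:R ^+ 2
          <= (count_entries (fun x : R => x < eps * alpha) A)%:R,
        `|sigma (complexmx A) 1 - alpha * n%:R / 2| < eps * alpha * n%:R,
        sigma (complexmx A) 2 < eps * alpha * n%:R
      & forall i : nat, eps * n%:R <= i%:R -> i%:R <= (1 - eps) * n%:R ->
        `|sigma (complexmx A) i - alpha * (n%:R `^ (1 / 2)) / 2|
          < eps * alpha * (n%:R `^ (1 / 2))].
Proof.
(* The defect bounds squares, so [d = c ^ 2] makes [c * L] the error for the first two singular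
   values. The bound [eps / 4] serves these and the entry counts; together with [eps ^ 2] it gives
   [d <= eps ^ 3 / 4], needed for the middle singular values. *)
have [c [c0 c12 ce ce2]] : exists c, [/\ 0 < c, c <= 1 / 2, c <= eps / 4
    & c <= eps ^+ 2].
  exists (Num.min (1 / 2) (Num.min (eps / 4) (eps ^+ 2))).
  rewrite !lt_min !ge_min !lexx !orbT; split=> //.
  by rewrite !divr_gt0 ?exprn_gt0 //= ltr0n.
pose d := c ^+ 2.
have d0 : 0 < d by rewrite exprn_gt0.
have d12 : d <= 1 / 2 by rewrite /d; nra.
have dc : d <= eps / 8 by rewrite /d; nra.
have de : d / eps <= eps / 16 by rewrite ler_pdivrMr // /d; nra.
have de3 : d <= eps ^+ 3 / 4 by rewrite /d expr2 exprS; nra.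
have dsq0 : 0 < (4 / d) ^+ 2 by rewrite exprn_gt0 // divr_gt0.
have e40 : 0 < 4 / eps by rewrite divr_gt0.
(* The other half of [d] absorbs the first two singular values: [n > (4 / d) ^ 2] gives
   [d * sqrt n >= 4], so [2 * L <= d / 2 * L * sqrt n]. The term [4 / eps] ensures
   [eps * n >= 4]. *)
exists (d / 2), (Num.bound (3 + (4 / d) ^+ 2 + 4 / eps)); split.
  by rewrite divr_gt0.
move=> n Nn A alpha A0 [_ Aa] alpha_big.
have alpha0 : 0 < alpha by lra.
have nbig : 3 + (4 / d) ^+ 2 + 4 / eps < n%:R.
  apply: (@lt_le_trans _ _ (Num.bound (3 + (4 / d) ^+ 2 + 4 / eps))%:R).
    by apply: archi_boundP; lra.
  by rewrite ler_nat.
have n3 : (3 <= n)%N by rewrite -(ler_nat R); lra.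
have n0 : 0 < n%:R :> R by lra.
have en : 4 <= eps * n%:R.
  by rewrite mulrC -ler_pdivrMr //; lra.
have AB i j : 0 <= A i j <= alpha by rewrite A0 Aa.
pose r : R := Num.sqrt n%:R.
have r2 : r ^+ 2 = n%:R by rewrite sqr_sqrtr ?ler0n.
have rbig : 4 <= d * r.
  rewrite mulrC -ler_pdivrMr //.
  have d4 : 0 <= 4 / d by rewrite divr_ge0 // ltW.
  by rewrite -(ger0_norm d4) -sqrtr_sqr ler_wsqrtr //; lra.
have r12 : n%:R `^ (1 / 2) = r by rewrite div1r powR12_sqrt ?ler0n.
have r32 : n%:R `^ (3 / 2) = n%:R * r.
  rewrite (_ : 3 / 2 = 1 + 1 / 2); last by lra.
  by rewrite powRD ?r12 ?powRr1 ?ler0n // (gt_eqF n0) implybT.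
rewrite r12 r32 => hE.
have n2 : (2 <= n)%N by exact: ltnW.
have [s1L s2L] := sigma1_sigma2_le n2 alpha0 AB.
have L0 : 0 < alpha * n%:R by rewrite mulr_gt0.
have T3_ge : alpha * (1 / 2 - d) * (n%:R * r)
    <= \sum_(3 <= k < n.+1) sigma (complexmx A) k.
  move: hE; rewrite energy_split //.
  have := ler_wpM2l (ltW L0) rbig.
  by move: s1L s2L; lra.
have defect := energy_defect n2 alpha0 d12 T3_ge.
have spread := tail_spread n2 alpha0 AB T3_ge.
have hQ := sum_sqr_entries_le AB; have hS := sum_entries_le_sigma1 AB.
have hAS := ler_wpM2l (ltW alpha0) hS.
have s20 := sigma_ge0 (complexmx A) 2.
set L := alpha * n%:R in L0 s1L s2L defect spread *.
have L20 : 0 < L ^+ 2 by rewrite exprn_gt0.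
have cL0 : 0 <= c * L by rewrite mulr_ge0 ?ltW.
have cLe : c * L < eps * L by rewrite ltr_pM2r //; lra.
have cL2 := ler_wpM2r (ltW L20) ce.
have dL2 := ler_wpM2r (ltW L20) dc.
have deL2 := ler_wpM2r (ltW L20) de.
have LE : n%:R ^+ 2 * alpha ^+ 2 = L ^+ 2 by rewrite /L; ring.
have countE : alpha ^+ 2 * ((1 / 2 - eps) * n%:R ^+ 2) = (1 / 2 - eps) * L ^+ 2.
  by rewrite /L; ring.
have epsL : eps * alpha * n%:R = eps * L by rewrite /L mulrA.
have hs1 := sqr_ge0 (sigma (complexmx A) 1 - L / 2).
have hs2 := sqr_ge0 (sigma (complexmx A) 2).
have AS_le : alpha * \sum_i \sum_j A i j <= L * sigma (complexmx A) 1.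
  by rewrite /L -mulrA.
have gap : alpha * \sum_i \sum_j A i j - \sum_i \sum_j A i j ^+ 2 <= d * L ^+ 2.
  by lra.
have gap_eps : eps^-1 *
    (alpha * \sum_i \sum_j A i j - \sum_i \sum_j A i j ^+ 2)
    <= eps / 16 * L ^+ 2.
  by apply: le_trans deL2; rewrite -mulrA mulrCA ler_pM2l ?invr_gt0.
have sigma1_near : `|sigma (complexmx A) 1 - L / 2| <= c * L.
  rewrite -(@ler_pXn2r _ 2) ?nnegrE // real_normK ?num_real //.
  by rewrite exprMn -/d; lra.
have /andP[s1lo s1hi] : - (c * L) <= sigma (complexmx A) 1 - L / 2 <= c * L.
  by rewrite -ler_norml.
have Ls1lo := ler_wpM2l (ltW L0) s1lo; have Ls1hi := ler_wpM2l (ltW L0) s1hi.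
have alpha20 : 0 < alpha ^+ 2 by rewrite exprn_gt0.
split.
(* For both counts the sum of squares is at least [(1 / 2 - c - d) * L ^ 2], and the correction is
   at most [eps / 16 * L ^ 2]; the total loss stays below [eps * L ^ 2]. *)
- rewrite -(ler_pM2l alpha20) countE.
  by have := count_large_entries heps AB; lra.
- rewrite -(ler_pM2l alpha20) countE.
  by have := count_small_entries heps AB; rewrite sum_complement_sqr LE; lra.
- by rewrite epsL (le_lt_trans sigma1_near).
- rewrite epsL; apply: le_lt_trans cLe.
  by rewrite -(@ler_pXn2r _ 2) ?nnegrE // exprMn -/d; lra.
- move=> i ilo ihi.
  have i_n : i%:R <= n%:R :> R by lra.
  have i3 : (3 <= i)%N by rewrite -(ler_nat R); lra.
  rewrite ler_nat in i_n.
  have h2 : (eps * alpha * r) ^+ 2 * n%:R = eps ^+ 2 * L ^+ 2.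
    by rewrite !exprMn r2 /L; ring.
  (* The right side is [eps ^ 3 / 2 * L ^ 2]. At least [eps * n / 2] indices lie on each side of
     [i], counting [i] itself: [eps * n >= 4] compensates for the two indices dropped at the
     start. *)
  have hE3 : d * L ^+ 2 < eps / 2 * n%:R * (eps * alpha * r) ^+ 2.
    rewrite -mulrA [n%:R * _]mulrC h2 mulrA ltr_pM2r //.
    by rewrite exprS in de3; have := exprn_gt0 2 heps; have := exprn_gt0 3 heps;
      rewrite exprS; lra.
  have h0 : 0 <= eps * alpha * r by rewrite !mulr_ge0 ?sqrtr_ge0 ?ltW.
  apply: (nonincreasing_near (fun j k => @sigma_le _ _ _ _ j k) h0 _ spread).
  + by rewrite i3.
  + apply: (lt_le_trans hE3); rewrite ler_wpM2r ?sqr_ge0 //.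
    by rewrite natrB ?(ltnW i3) //; lra.
  + apply: (lt_le_trans hE3); rewrite ler_wpM2r ?sqr_ge0 //.
    by rewrite subSn // -[leRHS]natr1 natrB //; lra.
Qed.
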